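(* Let $(\mathfrak{M},w)$ and $(\mathfrak{N},v)$ be pointed models over a signature $\Delta$. (1) If there is a back-and-forth system $\mathcal{I}$ between $\mathfrak{M}$ and $\mathfrak{N}$ with $h(w)=v$ for some $h\in\mathcal{I}$, then $(\mathfrak{M},w)\approx_\omega(\mathfrak{N},v)$. (2) Assume that $\downarrow\in\mathcal{O}$, and that $@\in\mathcal{O}$ whenever $\Diamond\in\mathcal{O}$ or $\exists\in\mathcal{O}$. If $(\mathfrak{M},w)\approx_\omega(\mathfrak{N},v)$, then there is a back-and-forth system $\mathcal{I}$ between $\mathfrak{M}$ and $\mathfrak{N}$ with $h(w)=v$ for some $h\in\mathcal{I}$.
   Context: Hybrid-dynamic propositional logic (HDPL). A signature is $\Delta=((F,P),\mathtt{Prop})$ with $F$ nominals, $P$ binary relation symbols, $\mathtt{Prop}$ propositional symbols; $\Delta[x]$ adds a fresh nominal $x$. A $\Delta$-model $\mathfrak{M}$: a nonempty set $|\mathfrak{M}|$ of states, states $k^{\mathfrak{M}}$, relations $\lambda^{\mathfrak{M}}$, and $M(w)\subseteq\mathtt{Prop}$ per state; $\mathfrak{M}[x\leftarrow w]$ is the $\Delta[x]$-expansion with $x$ interpreted as $w$. Actions: $\mathfrak{a}::=\lambda\mid\mathfrak{a}\cup\mathfrak{a}\mid\mathfrak{a};\mathfrak{a}\mid\mathfrak{a}^*$ (union, composition, reflexive-transitive closure); $\mathfrak{a}^{\mathfrak{M}}(w)=\{w'\mid(w,w')\in\mathfrak{a}^{\mathfrak{M}}\}$. $\mathcal{L}$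 is a fixed fragment of HDPL obtained by discarding some action constructors and/or some of the sentence constructors $\Diamond$ (possibility $\langle\mathfrak{a}\rangle$), $@$ (retrieve), $\downarrow$ (store), $\exists$; $\mathcal{O}\subseteq\{\Diamond,@,\downarrow,\exists\}$ is the set retained, $\mathcal{A}(\Delta)$ the $\mathcal{L}$-actions. Basic sentences $\mathrm{Sen}_b(\Delta)=F\cup\mathtt{Prop}$ ($k$ holds at $w$ iff $w=k^{\mathfrak{M}}$; $p$ iff $p\in M(w)$). Countable EF game: on the complete gameboard tree of height $\omega$, in which every node labelled $\Delta'$ has exactly one outgoing edge for each of: $1$ (to $\Delta'$); $\downarrow$ (to $\Delta'[x]$, $x$ fresh) if $\downarrow\in\mathcal{O}$; $\exists$ (to $\Delta'[x]$) if $\exists\in\mathcal{O}$; $@_k$ for each nominal $k$ of $\Delta'$ if $@\in\mathcal{O}$; $\langle\mathfrak{a}\rangle$ for each $\mathfrak{a}\in\mathcal{A}(\Delta')$ if $\Diamond\in\mathcal{O}$. Positions are nodes with two pointed models over the node's signature, starting at the root with $(\mathfrak{M},w),(\mathfrak{N},v)$. Eloise loses at a position if the pointed models disagree on a basic sentence. Otherwise Abelard picks an edge and one pointed model, say $(\mathfrak{M},w)$ (symmetric otherwise): $\langle\mathfrak{a}\rangle$: Abelard picks $w_1\in\mathfrak{a}^{\mathfrak{M}}(w)$, Eloise must pick $v_1\in\mathfrak{a}^{\mathfrak{N}}(v)$; $@_k$: new pair $(\mathfrak{M},k^{\mathfrak{M}}),(\mathfrak{N},k^{\mathfrak{N}})$;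 $\downarrow$: $(\mathfrak{M}[x\leftarrow w],w),(\mathfrak{N}[x\leftarrow v],v)$; $\exists$: Abelard picks $w_1\in|\mathfrak{M}|$, Eloise $v_1\in|\mathfrak{N}|$, new pair $(\mathfrak{M}[x\leftarrow w_1],w),(\mathfrak{N}[x\leftarrow v_1],v)$; $1$: unchanged. $(\mathfrak{M},w)\approx_\omega(\mathfrak{N},v)$ means Eloise can keep agreement on basic sentences at every position forever. A basic partial isomorphism $h:\mathfrak{M}\nrightarrow\mathfrak{N}$ is a bijection between a subset of $|\mathfrak{M}|$ and a subset of $|\mathfrak{N}|$ such that $(\mathfrak{M},u)$ and $(\mathfrak{N},h(u))$ satisfy the same basic sentences for all $u\in\mathrm{dom}(h)$; $h\subseteq g$ means $g$ extends $h$. A back-and-forth system between $\mathfrak{M},\mathfrak{N}$ is a nonempty family $\mathcal{I}$ of basic partial isomorphisms such that: ($@$-extension) if $@\in\mathcal{O}$, each $h\in\mathcal{I}$ and $k\in F$ admit $g\in\mathcal{I}$, $h\subseteq g$, $k^{\mathfrak{M}}\in\mathrm{dom}(g)$; ($\Diamond$-extension) if $\mathcal{L}$ has possibility over action $\mathfrak{a}$: (forth) for $h\in\mathcal{I}$, $w_1\in\mathrm{dom}(h)$, $w_1\mathrel{\mathfrak{a}^{\mathfrak{M}}}w_2$ there is $g\in\mathcal{I}$, $h\subseteq g$, $w_2\in\mathrm{dom}(g)$, $g(w_1)\mathrel{\mathfrak{a}^{\mathfrak{N}}}g(w_2)$; (back) for $h\in\mathcal{I}$, $v_1\in\mathrm{rng}(h)$,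 $v_1\mathrel{\mathfrak{a}^{\mathfrak{N}}}v_2$ there is $g\in\mathcal{I}$, $h\subseteq g$, $v_2\in\mathrm{rng}(g)$, $g^{-1}(v_1)\mathrel{\mathfrak{a}^{\mathfrak{M}}}g^{-1}(v_2)$; ($\exists$-extension) if $\exists\in\mathcal{O}$, each $h\in\mathcal{I}$ extends within $\mathcal{I}$ to include any given $u\in|\mathfrak{M}|$ in its domain and any given $u'\in|\mathfrak{N}|$ in its range. *)

(* Defs.v *)
From Stdlib Require Import Relations.

Set Implicit Arguments.
Unset Strict Implicit.
Unset Printing Implicit Defensive.

(** * Signatures, models, basic sentences *)

Record signature : Type := Signature {
  nom : Type;
  rel : Type;
  prp : Type
}.

(* Delta[x]: the fresh nominal x is [None]. *)
Definition ext (D : signature) : signature :=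
  Signature (option (nom D)) (rel D) (prp D).

Record model (D : signature) : Type := Model {
  state : Type;
  state_inh : inhabited state;
  nom_in : nom D -> state;
  rel_in : rel D -> state -> state -> Prop;
  val_in : state -> prp D -> Prop
}.

(* M[x <- u] *)
Definition expand (D : signature) (M : model D) (u : state M) : model (ext D) :=
  @Model (ext D) (state M) (state_inh M)
    (fun k => match k with None => u | Some k' => nom_in M k' end)
    (@rel_in D M)
    (@val_in D M).

Inductive basic_sen (D : signature) : Type :=
| bs_nom (k : nom D)
| bs_prp (p : prp D).

Definition sat_basic (D : signature) (M : model D) (w : state M)
    (phi : basic_sen D) : Prop :=
  match phi with
  | bs_nom k => w = nom_in M k
  | bs_prp p => val_in w p
  end.

Definition basic_agree (D : signature) (M N : model D)
    (w : state M) (v : state N) : Prop :=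
  forall phi : basic_sen D, sat_basic w phi <-> sat_basic v phi.

(** * Actions and fragments *)

Inductive action (P : Type) : Type :=
| act_rel (l : P)
| act_union (a b : action P)
| act_comp (a b : action P)
| act_star (a : action P).

Fixpoint act_in (D : signature) (M : model D) (a : action (rel D)) :
    state M -> state M -> Prop :=
  match a with
  | act_rel l => rel_in l
  | act_union a b => fun u u' => act_in a u u' \/ act_in b u u'
  | act_comp a b => fun u u' => exists2 t, act_in a u t & act_in b t u'
  | act_star a => clos_refl_trans (state M) (act_in a)
  end.

Inductive act_con : Set := Union | Comp | Star.
Inductive sen_con : Set := Dia | At | Store | Ex.

(* A fragment is given by the constructors it retains; the relation symbols
   themselves, which are the atoms of the action grammar, are always kept. *)
Record fragment : Type := Fragment {
  act_ops : act_con -> Prop;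
  sen_ops : sen_con -> Prop
}.

Fixpoint frag_action (L : fragment) (P : Type) (a : action P) : Prop :=
  match a with
  | act_rel _ => True
  | act_union a b => act_ops L Union /\ frag_action L a /\ frag_action L b
  | act_comp a b => act_ops L Comp /\ frag_action L a /\ frag_action L b
  | act_star a => act_ops L Star /\ frag_action L a
  end.

(** * The countable Ehrenfeucht-Fraisse game *)

Inductive edge (D : signature) : Type :=
| e_one
| e_store
| e_ex
| e_at (k : nom D)
| e_dia (a : action (rel D)).

Arguments e_one {D}.
Arguments e_store {D}.
Arguments e_ex {D}.

(* The edges leaving a node labelled D in the complete gameboard tree. *)
Definition on_board (L : fragment) (D : signature) (e : edge D) : Prop :=
  match e with
  | e_one => True
  | e_store => sen_ops L Store
  | e_ex => sen_ops L Ex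
  | e_at _ => sen_ops L At
  | e_dia a => sen_ops L Dia /\ frag_action L a
  end.

(* A node of the complete gameboard tree is the path of edges leading to it, and
   what lies below it depends only on its label.  A position therefore carries
   just the label; the path itself is part of the history [play] below. *)
Record position : Type := Position {
  psig : signature;
  pM : model psig;
  pw : state pM;
  pN : model psig;
  pv : state pN
}.

(* Abelard's choice along an edge: one of the two pointed models ([inl] for the
   first, [inr] for the second) and, for [e_ex] and [e_dia], a state in it. *)
Definition challenge (p : position) (e : edge (psig p)) : Type :=
  match e with
  | e_ex | e_dia _ => (state (pM p) + state (pN p))%type
  | e_one | e_store | e_at _ => (unit + unit)%type
  end.

Definition legal_challenge (p : position) (e : edge (psig p)) :
    challenge e -> Prop :=
  match e return challenge e -> Prop with
  | e_dia a => fun c =>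
      match c with
      | inl w1 => act_in a (pw p) w1
      | inr v1 => act_in a (pv p) v1
      end
  | _ => fun _ => True
  end.

(* Eloise's reply is a state of the model not chosen by Abelard, when the edge
   calls for one. *)
Definition reply (p : position) (e : edge (psig p)) : challenge e -> Type :=
  match e return challenge e -> Type with
  | e_ex | e_dia _ => fun c =>
      match c with
      | inl _ => state (pN p)
      | inr _ => state (pM p)
      end
  | _ => fun _ => unit
  end.

Definition legal_reply (p : position) (e : edge (psig p)) :
    forall c : challenge e, reply c -> Prop :=
  match e return forall c : challenge e, reply c -> Prop with
  | e_dia a => fun c =>
      match c return reply (e := e_dia a) c -> Prop with
      | inl _ => fun v1 => act_in a (pv p) v1
      | inr _ => fun w1 => act_in a (pw p) w1
      end
  | _ => fun _ _ => True
  end.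

Definition next (p : position) (e : edge (psig p)) :
    forall c : challenge e, reply c -> position :=
  match e return forall c : challenge e, reply c -> position with
  | e_one => fun _ _ => p
  | e_store => fun _ _ =>
      @Position (ext (psig p))
        (expand (pw p)) (pw p)
        (expand (pv p)) (pv p)
  | e_at k => fun _ _ =>
      @Position (psig p)
        (pM p) (nom_in (pM p) k)
        (pN p) (nom_in (pN p) k)
  | e_ex => fun c =>
      match c return reply (e := e_ex) c -> position with
      | inl w1 => fun v1 =>
          @Position (ext (psig p)) (expand w1) (pw p) (expand v1) (pv p)
      | inr v1 => fun w1 =>
          @Position (ext (psig p)) (expand w1) (pw p) (expand v1) (pv p)
      end
  | e_dia a => fun c =>
      match c return reply (e := e_dia a) c -> position with
      | inl w1 => fun v1 => @Position (psig p) (pM p) w1 (pN p) v1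
      | inr v1 => fun w1 => @Position (psig p) (pM p) w1 (pN p) v1
      end
  end.

(* Finite histories from p0, not yet subject to the rules. *)
Inductive play (p0 : position) : position -> Type :=
| play_start : play p0 p0
| play_step (p : position) (h : play p0 p)
    (e : edge (psig p)) (c : challenge e) (r : reply c) :
    play p0 (next r).

Definition strategy (p0 : position) : Type :=
  forall (p : position) (h : play p0 p) (e : edge (psig p)) (c : challenge e),
    reply c.

(* Histories in which Abelard obeys the rules and Eloise follows s. *)
Inductive follows (L : fragment) (p0 : position) (s : strategy p0) :
    forall p : position, play p0 p -> Prop :=
| follows_start : follows L s (play_start p0)
| follows_step (p : position) (h : play p0 p)
    (e : edge (psig p)) (c : challenge e) :
    follows L s h -> on_board L e -> legal_challenge c ->
    follows L s (play_step h (s p h e c)).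

Definition winning (L : fragment) (p0 : position) (s : strategy p0) : Prop :=
  forall (p : position) (h : play p0 p), follows L s h ->
    basic_agree (pw p) (pv p) /\
    (forall (e : edge (psig p)) (c : challenge e),
        on_board L e -> legal_challenge c -> legal_reply (s p h e c)).

(* (M, w) ~~_omega (N, v) *)
Definition ef_equiv (L : fragment) (D : signature) (M N : model D)
    (w : state M) (v : state N) : Prop :=
  exists s : strategy (@Position D M w N v), winning L s.

(** * Back-and-forth systems *)

(* Partial maps between |M| and |N| are represented by their graphs. *)
Definition dom (D : signature) (M N : model D)
    (h : state M -> state N -> Prop) (u : state M) : Prop :=
  exists u', h u u'.

Definition rng (D : signature) (M N : model D)
    (h : state M -> state N -> Prop) (u' : state N) : Prop :=
  exists u, h u u'.

Record basic_partial_iso (D : signature) (M N : model D)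
    (h : state M -> state N -> Prop) : Prop := {
  bpi_fun : forall u u1 u2, h u u1 -> h u u2 -> u1 = u2;
  bpi_inj : forall u1 u2 u', h u1 u' -> h u2 u' -> u1 = u2;
  bpi_basic : forall u u', h u u' -> basic_agree u u'
}.

Definition extends (D : signature) (M N : model D)
    (h g : state M -> state N -> Prop) : Prop :=
  forall u u', h u u' -> g u u'.

Record back_and_forth (D : signature) (M N : model D)
    (L : fragment) (I : (state M -> state N -> Prop) -> Prop) : Prop := {
  bf_nonempty : exists h, I h;
  bf_iso : forall h, I h -> basic_partial_iso h;
  bf_at : sen_ops L At ->
    forall h k, I h ->
    exists g, I g /\ extends h g /\ dom g (nom_in M k);
  bf_dia_forth : sen_ops L Dia ->
    forall a, frag_action L a ->
    forall h w1 w2, I h -> dom h w1 -> act_in a w1 w2 ->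
    exists g, I g /\ extends h g /\
      exists v1 v2, g w1 v1 /\ g w2 v2 /\ act_in a v1 v2;
  bf_dia_back : sen_ops L Dia ->
    forall a, frag_action L a ->
    forall h v1 v2, I h -> rng h v1 -> act_in a v1 v2 ->
    exists g, I g /\ extends h g /\
      exists w1 w2, g w1 v1 /\ g w2 v2 /\ act_in a w1 w2;
  bf_ex_forth : sen_ops L Ex ->
    forall h u, I h -> exists g, I g /\ extends h g /\ dom g u;
  bf_ex_back : sen_ops L Ex ->
    forall h u', I h -> exists g, I g /\ extends h g /\ rng g u'
}.

(* Main.v *)
(** Eloise wins exactly when the starting position lies in some set of
    positions, each agreeing on basic sentences, that she can never be forced to
    leave.

    (1) The positions [p] for which some back-and-forth system has a member
    relating the current states form such a set: when a fresh nominal is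
    interpreted as [u] and [u'] with [h u u'], the members extending [h] are a
    back-and-forth system for the expansions, since they keep [u] and [u']
    matched.

    (2) If [At] is not retained, neither are [Dia] and [Ex], and the single map
    [w |-> v] is a system.  Otherwise each reachable position yields the map
    [k^M |-> k^N], [k] ranging over the nominals of its signature; moving to [k]
    shows that it is a basic partial isomorphism, and it is enlarged by [Store]
    or [Ex]. *)

From Stdlib Require Import Relations Classical ClassicalEpsilon.
Require Import Defs.

Set Implicit Arguments.
Unset Strict Implicit.
Unset Printing Implicit Defensive.

(** * The game as an invariant *)

Definition game_invariant (L : fragment) (G : position -> Prop) : Prop :=
  forall p, G p ->
    basic_agree (pw p) (pv p) /\
    (forall (e : edge (psig p)) (c : challenge e),
        on_board L e -> legal_challenge c ->
        exists r : reply c, legal_reply r /\ G (next r)).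

(** A strategy is a total function, so it must answer illegal challenges too; nonempty state sets
    make this possible. *)
Lemma reply_inhabited (p : position) (e : edge (psig p)) (c : challenge e) :
  inhabited (reply c).
Proof.
destruct e; simpl in *; try exact (inhabits tt);
  destruct c; apply state_inh.
Qed.

(** A winning strategy yields the set of positions reached by histories following it. Conversely,
    [epsilon] selects at each position of [G] a legal reply that stays in [G]. *)
Lemma ef_equiv_iff_invariant (L : fragment) (D : signature) (M N : model D)
    (w : state M) (v : state N) :
  ef_equiv L w v <->
  exists G, game_invariant L G /\ G (@Position D M w N v).
Proof.
split.
- intros [s Hs].
  exists (fun p => exists h, @follows L (@Position D M w N v) s p h).
  split.
  + intros p [h Hh]. destruct (Hs p h Hh) as [Hb Hr].
    split; [exact Hb|]. intros e c He Hc. exists (s p h e c).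
    split; [now apply Hr|].
    exists (play_step h (s p h e c)). now constructor.
  + eexists. apply follows_start.
- intros [G [HG H0]].
  pose (s := (fun p _ e c =>
      epsilon (reply_inhabited c) (fun r => legal_reply r /\ G (next r)))
    : strategy (@Position D M w N v)).
  exists s.
  assert (Hs : forall p h e c, G p -> on_board L e -> legal_challenge c ->
            legal_reply (s p h e c) /\ G (next (s p h e c))).
  { intros p h e c Gp He Hc. apply epsilon_spec. now apply (HG p Gp). }
  assert (HF : forall p h, follows L s (p := p) h -> G p).
  { intros p h Hh. induction Hh as [|p h e c Hh IH He Hc]; [exact H0|].
    now apply Hs. }
  intros p h Hh. apply HF in Hh. split; [now apply HG|].
  intros e c He Hc. now apply Hs.
Qed.

(** * Reinterpreting the nominals *)

(** An arbitrary type [K] of nominals covers in one form every signature reached by repeatedly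
    adding fresh nominals. *)
Definition with_nominals (D : signature) (K : Type) : signature :=
  Signature K (rel D) (prp D).

(* [expand u] is convertible to an instance with [K := option (nom D)]. *)
Definition renominate (D : signature) (M : model D) (K : Type)
    (f : K -> state M) : model (with_nominals D K) :=
  @Model (with_nominals D K) (state M) (state_inh M) f
    (@rel_in D M) (@val_in D M).

Lemma act_in_renominate (D : signature) (M : model D) (K : Type)
    (f : K -> state M) (a : action (rel D)) (u u' : state M) :
  @act_in _ (renominate f) a u u' <-> act_in a u u'.
Proof.
revert u u'.
induction a as [l|a IHa b IHb|a IHa b IHb|a IHa]; intros u u'; simpl.
- reflexivity.
- now rewrite <- IHa, <- IHb.
- split; intros [t H1 H2]; exists t; now (apply IHa || apply IHb).
- split; intros H.
  + induction H; [now apply rt_step, IHa|apply rt_refl|eapply rt_trans; eauto].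
  + induction H; [now apply rt_step, IHa|apply rt_refl|eapply rt_trans; eauto].
Qed.

Definition option_case (K S : Type) (s : S) (f : K -> S) (o : option K) : S :=
  match o with None => s | Some k => f k end.

Lemma act_in_expand (D : signature) (M : model D) (x : state M)
    (a : action (rel D)) (u u' : state M) :
  @act_in _ (expand x) a u u' <-> act_in a u u'.
Proof. exact (act_in_renominate (option_case x (@nom_in D M)) a u u'). Qed.

(** * From back-and-forth systems to the game *)

Lemma back_and_forth_expand (L : fragment) (D : signature) (M N : model D)
    (I : (state M -> state N -> Prop) -> Prop) (h : state M -> state N -> Prop)
    (x : state M) (y : state N) :
  back_and_forth L I -> I h -> h x y ->
  @back_and_forth (ext D) (expand x) (expand y) L
    (fun g => I g /\ extends h g).
Proof.
intros B Ih hxy; split.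
- exists h; split; [exact Ih|now intros u u'].
- intros g [Ig hg]. destruct (bf_iso B Ig) as [Hf Hi Hb].
  split; [exact Hf|exact Hi|]. intros u u' guu' [[k|]|q].
  + exact (Hb u u' guu' (bs_nom k)).
  (* Since [g] relates [x] to [y], functionality and injectivity of [g] give [u = x] iff
     [u' = y]. *)
  + simpl. specialize (hg x y hxy).
    split; intros ->; [exact (Hf _ _ _ guu' hg)|exact (Hi _ _ _ guu' hg)].
  + exact (Hb u u' guu' (bs_prp (D := D) q)).
- intros HAt g [k|] [Ig hg].
  + destruct (bf_at B HAt k Ig) as [g' [Ig' [gg' dk]]].
    exists g'; repeat split; auto. now intros u u' H; apply gg', hg.
  + exists g; repeat split; auto; [now intros u u'|].
    exists y. now apply hg.
- intros HD a Ha g w1 w2 [Ig hg] dw1 Hw.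
  apply act_in_expand in Hw.
  destruct (bf_dia_forth B HD Ha Ig dw1 Hw) as [g' [Ig' [gg' [v1 [v2 Hv]]]]].
  exists g'; repeat split; auto; [now intros u u' H; apply gg', hg|].
  exists v1, v2. now rewrite act_in_expand.
- intros HD a Ha g v1 v2 [Ig hg] dv1 Hv.
  apply act_in_expand in Hv.
  destruct (bf_dia_back B HD Ha Ig dv1 Hv) as [g' [Ig' [gg' [w1 [w2 Hw]]]]].
  exists g'; repeat split; auto; [now intros u u' H; apply gg', hg|].
  exists w1, w2. now rewrite act_in_expand.
- intros HE g u [Ig hg]. destruct (bf_ex_forth B HE u Ig) as [g' [Ig' [gg' d]]].
  exists g'; repeat split; auto. now intros t t' H; apply gg', hg.
- intros HE g u [Ig hg]. destruct (bf_ex_back B HE u Ig) as [g' [Ig' [gg' d]]].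
  exists g'; repeat split; auto. now intros t t' H; apply gg', hg.
Qed.

Definition bf_related (L : fragment) (p : position) : Prop :=
  exists I, @back_and_forth (psig p) (pM p) (pN p) L I /\
    exists h, I h /\ h (pw p) (pv p).

Lemma bf_related_invariant (L : fragment) : game_invariant L (bf_related L).
Proof.
intros [D M w N v] [I [B [h [Ih hwv]]]]; simpl in *.
split; [exact (bpi_basic (bf_iso B Ih) hwv)|].
intros [| | |k|a] c He Hc; simpl in *.
- exists tt; split; [exact Logic.I|]. now exists I; split; [|exists h].
- exists tt; split; [exact Logic.I|].
  exists (fun g => I g /\ extends h g).
  split; [exact (back_and_forth_expand B Ih hwv)|].
  exists h; split; [split; [exact Ih|now intros u u']|exact hwv].
- destruct c as [w1|v1].
  + destruct (bf_ex_forth B He w1 Ih) as [g [Ig [hg [v1 g1]]]].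
    exists v1; split; [exact Logic.I|].
    (* Members extending [g], and not merely [h], keep the values [w1] and [v1] of the fresh nominal
       matched. *)
    exists (fun g' => I g' /\ extends g g').
    split; [exact (back_and_forth_expand B Ig g1)|].
    exists g; split; [split; [exact Ig|now intros u u']|]. now apply hg.
  + destruct (bf_ex_back B He v1 Ih) as [g [Ig [hg [w1 g1]]]].
    exists w1; split; [exact Logic.I|].
    exists (fun g' => I g' /\ extends g g').
    split; [exact (back_and_forth_expand B Ig g1)|].
    exists g; split; [split; [exact Ig|now intros u u']|]. now apply hg.
- exists tt; split; [exact Logic.I|].
  destruct (bf_at B He k Ih) as [g [Ig [hg [y gy]]]].
  exists I; split; [exact B|]. exists g; split; [exact Ig|]. simpl.
  (* [g] relates the state named [k] in [M] to [y]; basic agreement on [k] forces [y] to be the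
     state named [k] in [N]. *)
  destruct (bpi_basic (bf_iso B Ig) gy (bs_nom k)) as [Hk _].
  now rewrite <- (Hk eq_refl).
- destruct He as [HD Ha]. destruct c as [w1|v1].
  + destruct (bf_dia_forth B HD Ha Ih (ex_intro _ v hwv) Hc)
      as [g [Ig [hg [v' [v1 [g0 [g1 Hv]]]]]]].
    (* The partner [v'] of [w] under [g] is the current state [v], because [g] is functional and
       extends [h]. *)
    rewrite (bpi_fun (bf_iso B Ig) g0 (hg _ _ hwv)) in Hv.
    exists v1; split; [exact Hv|].
    now exists I; split; [|exists g].
  + destruct (bf_dia_back B HD Ha Ih (ex_intro _ w hwv) Hc)
      as [g [Ig [hg [w' [w1 [g0 [g1 Hw]]]]]]].
    rewrite (bpi_inj (bf_iso B Ig) g0 (hg _ _ hwv)) in Hw.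
    exists w1; split; [exact Hw|].
    now exists I; split; [|exists g].
Qed.

(** * From the game to back-and-forth systems *)

Definition named_pairs (K S T : Type) (f : K -> S) (g : K -> T) : S -> T -> Prop :=
  fun u u' => exists k, u = f k /\ u' = g k.

Definition renominated_position (D : signature) (M N : model D) (K : Type)
    (f : K -> state M) (g : K -> state N) (w : state M) (v : state N) : position :=
  @Position (with_nominals D K) (renominate f) w (renominate g) v.

(** [K] holds the nominals of a position in [G], and [i] locates those of [D] among them. The
    current states are quantified away, since the map depends only on the names. *)
Definition game_system (G : position -> Prop) (D : signature) (M N : model D)
    (h : state M -> state N -> Prop) : Prop :=
  exists (K : Type) (i : nom D -> K) (f : K -> state M) (g : K -> state N) w v,
    (forall k, f (i k) = nom_in M k) /\ (forall k, g (i k) = nom_in N k) /\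
    h = named_pairs f g /\ G (renominated_position f g w v).

Lemma game_system_option (G : position -> Prop) (D : signature) (M N : model D)
    (K : Type) (i : nom D -> K) (f : K -> state M) (g : K -> state N)
    (x w : state M) (y v : state N) :
  (forall k, f (i k) = nom_in M k) -> (forall k, g (i k) = nom_in N k) ->
  G (renominated_position (option_case x f) (option_case y g) w v) ->
  exists h, game_system G h /\ extends (named_pairs f g) h /\ h x y.
Proof.
intros Hf Hg HG. exists (named_pairs (option_case x f) (option_case y g)).
split; [|split].
- exists (option K), (fun k => Some (i k)), (option_case x f), (option_case y g),
    w, v. now repeat split.
- intros u u' [k Hk]. now exists (Some k).
- now exists None.
Qed.

Lemma game_invariant_at (L : fragment) (G : position -> Prop) (D : signature)
    (M N : model D) (K : Type) (f : K -> state M) (g : K -> state N) w v (k : K) :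
  game_invariant L G -> sen_ops L At ->
  G (renominated_position f g w v) -> G (renominated_position f g (f k) (g k)).
Proof.
intros HG HAt Hp.
destruct (proj2 (HG _ Hp) (e_at (D := with_nominals D K) k) (inl tt) HAt Logic.I) as [r [_ H]].
exact H.
Qed.

Lemma game_invariant_store (L : fragment) (G : position -> Prop) (D : signature)
    (M N : model D) (K : Type) (f : K -> state M) (g : K -> state N) w v :
  game_invariant L G -> sen_ops L Store ->
  G (renominated_position f g w v) ->
  G (renominated_position (option_case w f) (option_case v g) w v).
Proof.
intros HG HS Hp.
destruct (proj2 (HG _ Hp) e_store (inl tt) HS Logic.I) as [r [_ H]].
exact H.
Qed.

Lemma game_system_back_and_forth (L : fragment) (G : position -> Prop)
    (D : signature) (M N : model D) :
  game_invariant L G -> sen_ops L Store -> sen_ops L At ->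
  (exists h, @game_system G D M N h) ->
  back_and_forth L (@game_system G D M N).
Proof.
intros HG HS HAt Hne; split; [exact Hne| | | | | |].
- intros h [K [i [f [g [w [v [Hf [Hg [-> Hp]]]]]]]]].
  assert (Hb : forall k, @basic_agree _ (renominate f) (renominate g) (f k) (g k)).
  { intros k. exact (proj1 (HG _ (game_invariant_at k HG HAt Hp))). }
  split.
  (* If [k] and [l] name the same state in [M], the basic sentence [l] holds at [f k], hence at
     [g k], so [g k = g l]. *)
  + intros u u1 u2 [k [-> ->]] [l [H ->]].
    exact (proj1 (Hb k (bs_nom (D := with_nominals D K) l)) H).
  + intros u1 u2 u' [k [-> ->]] [l [-> H]].
    exact (proj2 (Hb k (bs_nom (D := with_nominals D K) l)) H).
  + intros u u' [k [-> ->]] [l|q].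
    * simpl. rewrite <- Hf, <- Hg.
      exact (Hb k (bs_nom (D := with_nominals D K) (i l))).
    * exact (Hb k (bs_prp (D := with_nominals D K) q)).
- intros _ h k Ih. exists h; repeat split; auto; [now intros u u'|].
  destruct Ih as [K [i [f [g [w [v [Hf [Hg [-> Hp]]]]]]]]].
  exists (nom_in N k), (i k). now rewrite Hf, Hg.
- intros HD a Ha h w1 w2 [K [i [f [g [w [v [Hf [Hg [-> Hp]]]]]]]]] [v1 [k [-> ->]]] Hw.
  (* [At] moves to the pair named [k], [Dia] leads to [w2] and a reply [v2], and [Store] names this
     new pair so that the enlarged map contains it. *)
  apply (game_invariant_at k HG HAt) in Hp.
  apply (act_in_renominate f) in Hw.
  destruct (proj2 (HG _ Hp) (e_dia (D := with_nominals D K) a)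
              (inl w2) (conj HD Ha) Hw) as [v2 [Hv Hq]].
  apply (game_invariant_store HG HS (f := f) (g := g)) in Hq.
  destruct (game_system_option Hf Hg Hq) as [h' [Ih' [hh' H2]]].
  exists h'; split; [exact Ih'|split; [exact hh'|]].
  exists (g k), v2; split; [apply hh'; now exists k|split; [exact H2|]].
  exact (proj1 (act_in_renominate g a (g k) v2) Hv).
- intros HD a Ha h v1 v2 [K [i [f [g [w [v [Hf [Hg [-> Hp]]]]]]]]] [w1 [k [-> ->]]] Hv.
  apply (game_invariant_at k HG HAt) in Hp.
  apply (act_in_renominate g) in Hv.
  destruct (proj2 (HG _ Hp) (e_dia (D := with_nominals D K) a)
              (inr v2) (conj HD Ha) Hv) as [w2 [Hw Hq]].
  apply (game_invariant_store HG HS (f := f) (g := g)) in Hq.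
  destruct (game_system_option Hf Hg Hq) as [h' [Ih' [hh' H2]]].
  exists h'; split; [exact Ih'|split; [exact hh'|]].
  exists (f k), w2; split; [apply hh'; now exists k|split; [exact H2|]].
  exact (proj1 (act_in_renominate f a (f k) w2) Hw).
- intros HE h x [K [i [f [g [w [v [Hf [Hg [-> Hp]]]]]]]]].
  (* An [Ex] move itself adds the nominal naming [x] and the reply [y]. *)
  destruct (proj2 (HG _ Hp) e_ex (inl x) HE Logic.I) as [y [_ Hq]].
  destruct (game_system_option Hf Hg Hq) as [h' [Ih' [hh' H2]]].
  exists h'; repeat split; auto. now exists y.
- intros HE h y [K [i [f [g [w [v [Hf [Hg [-> Hp]]]]]]]]].
  destruct (proj2 (HG _ Hp) e_ex (inr y) HE Logic.I) as [x [_ Hq]].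
  destruct (game_system_option Hf Hg Hq) as [h' [Ih' [hh' H2]]].
  exists h'; repeat split; auto. now exists x.
Qed.

(** Without these constructors every extension clause is vacuous, and a single agreeing pair is a
    basic partial isomorphism. *)
Lemma singleton_back_and_forth (L : fragment) (D : signature) (M N : model D)
    (w : state M) (v : state N) :
  ~ sen_ops L At -> ~ sen_ops L Dia -> ~ sen_ops L Ex -> basic_agree w v ->
  back_and_forth L (fun h => h = (fun u u' => u = w /\ u' = v)).
Proof.
intros nAt nDia nEx Hb; split; try contradiction.
- now eexists.
- intros h ->; split.
  + intros u u1 u2 [_ H1] [_ H2]. congruence.
  + intros u1 u2 u' [H1 _] [H2 _]. congruence.
  + now intros u u' [-> ->].
Qed.

Theorem mainTheorem6 (L : fragment) (D : signature) (M N : model D)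
    (w : state M) (v : state N) :
  ((exists I : (state M -> state N -> Prop) -> Prop,
      back_and_forth L I /\ exists h, I h /\ h w v) ->
   ef_equiv L w v)
  /\
  (sen_ops L Store ->
   (sen_ops L Dia \/ sen_ops L Ex -> sen_ops L At) ->
   ef_equiv L w v ->
   exists I : (state M -> state N -> Prop) -> Prop,
     back_and_forth L I /\ exists h, I h /\ h w v).
Proof.
split.
- intros HI. apply ef_equiv_iff_invariant.
  exists (bf_related L). split; [apply bf_related_invariant|exact HI].
- intros HS HAt HE. apply ef_equiv_iff_invariant in HE as [G [HG Hp]].
  destruct (classic (sen_ops L At)) as [At|nAt].
  (* Storing once names the starting states, so the map of the resulting position relates [w] to
     [v]. *)
  + destruct (proj2 (HG _ Hp) e_store (inl tt) HS Logic.I) as [r [_ Hq]].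
    destruct (@game_system_option G D M N (nom D) (fun k => k)
                (@nom_in D M) (@nom_in D N) w w v v
                (fun _ => eq_refl) (fun _ => eq_refl) Hq) as [h [Ih [_ hwv]]].
    exists (@game_system G D M N). split; [|now exists h].
    apply game_system_back_and_forth; auto. now exists h.
  + exists (fun h => h = (fun u u' => u = w /\ u' = v)).
    split; [|now eexists; split; [reflexivity|]].
    apply singleton_back_and_forth; auto. exact (proj1 (HG _ Hp)).
Qed.
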